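(* Let $n\ge 1$ and $m\ge 2$. For metric (simultaneous) transportation games with $n$ players and $m$ buses, $\mathrm{PoS}(U)\ge 2\frac{n}{m}-1$, even when restricted to games in which all buses have the same permutation. That is, if $\mathcal{G}$ is the class of metric transportation games with $n$ players and $m$ buses that possess a Nash equilibrium and in which $\pi_1=\dots=\pi_m$, then $\mathrm{PoS}(U,\mathcal{G})\ge 2\frac{n}{m}-1$.
   Context: Transportation game. An instance $\Gamma$ consists of a set of players $N=\{1,\dots,n\}$ ($n\ge 1$), a set of buses $M=\{1,\dots,m\}$ with $m\ge 2$, a complete undirected graph on the vertex set $V=N\cup\{s,t\}$ ($s$ the source, $t$ the destination) with a distance function $d$ assigning a nonnegative real $d(x,y)=d(y,x)$ to each edge (with $d(x,x)=0$), and for each bus $j\in M$ a permutation $\pi_j$ of $N$. The instance is metric if $d(x,w)\le d(x,y)+d(y,w)$ for all $x,y,w\in V$. Distances between distinct vertices may be $0$. An outcome is a map $\sigma:N\to M$, $\sigma_i$ being the bus chosen by player $i$; $\mathcal{P}$ is the set of outcomes. Given $\sigma$, bus $j$ starts at $s$, visits exactly the players $i$ with $\sigma_i=j$, in the order in which they appear in $\pi_j$, and ends at $t$. Let $n_j=|\{i:\sigma_i=j\}|$, let $p^j_i$ be the $i$-th player visited by bus $j$, and put $p^j_{n_j+1}=t$. The cost of the player $p^j_k$ is $c_{p^j_k}(\sigma)=\sum_{l=k}^{n_j} d(p^j_l,p^j_{l+1})$, the distance travelled by her bus from her location to $t$. The utilitarian social cost function is $U(\sigma)=\sum_{i\in N}c_i(\sigma)$.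 An outcome $\sigma$ is a (pure) Nash equilibrium if for every $i\in N$ and every outcome $\sigma'$ with $\sigma'_i\ne\sigma_i$ and $\sigma'_k=\sigma_k$ for all $k\ne i$, $c_i(\sigma)\le c_i(\sigma')$. Let $\mathrm{NE}(\Gamma)$ be the set of Nash equilibria. Only games with $\mathrm{NE}(\Gamma)\neq\emptyset$ are considered. With $\sigma^*\in\mathcal{P}$ minimizing $f$, $\mathrm{PoS}(f,\Gamma)=\min_{\sigma\in \mathrm{NE}(\Gamma)} f(\sigma)/f(\sigma^* )$, and for a class $\mathcal{G}$ of games $\mathrm{PoS}(f,\mathcal{G})=\sup_{\Gamma\in\mathcal{G}}\mathrm{PoS}(f,\Gamma)$, the supremum being over the $\Gamma\in\mathcal{G}$ with $f(\sigma^* )>0$. *)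

(* Defs.v *)
From HB Require Import structures.
From mathcomp Require Import all_boot all_order all_algebra all_fingroup.
From mathcomp Require Import all_classical all_reals ereal.

Set Implicit Arguments.
Unset Strict Implicit.
Unset Printing Implicit Defensive.

Import Order.TTheory GRing.Theory Num.Theory.

Local Open Scope classical_set_scope.
Local Open Scope ring_scope.

Inductive vertex (n : nat) : Type :=
  | Source
  | Target
  | Player of 'I_n.

Arguments Source {n}.
Arguments Target {n}.

(* [bus_order j k] is the player in position [k] of the permutation of bus [j]. *)
Record game (R : realType) (n m : nat) : Type := Game {
  players_gt0 : (0 < n)%N;
  buses_gt1 : (1 < m)%N;
  dist : vertex n -> vertex n -> R;
  dist_ge0 : forall x y, 0 <= dist x y;
  dist_sym : forall x y, dist x y = dist y x;
  dist_refl : forall x, dist x x = 0;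
  bus_order : 'I_m -> {perm 'I_n}
}.

Definition outcome (n m : nat) := {ffun 'I_n -> 'I_m}.

Section Games.
Context {R : realType} {n m : nat}.
Implicit Types (G : game R n m) (s : outcome n m) (i : 'I_n) (j : 'I_m).

Definition is_metric G : Prop :=
  forall x y w, dist G x w <= dist G x y + dist G y w.

Definition same_order G : Prop := forall j j', bus_order G j = bus_order G j'.

Definition visited G s j : seq 'I_n :=
  [seq i <- [seq bus_order G j k | k <- enum 'I_n] | s i == j].

(* Zero-based: [stop G s j l] is the [l]-th player visited by bus [j] if there
   is one, and the destination if [l] is the number of players visited. *)
Definition stop G s j (l : nat) : vertex n :=
  nth Target [seq Player i | i <- visited G s j] l.

Definition cost G s i : R :=
  let j := s i in
  \sum_(index i (visited G s j) <= l < size (visited G s j))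
    dist G (stop G s j l) (stop G s j l.+1).

Definition utilitarian G s : R := \sum_(i < n) cost G s i.

Definition nash G s : bool :=
  [forall i, forall s' : outcome n m,
    (s' i != s i) && [forall k, (k != i) ==> (s' k == s k)] ==>
    (cost G s i <= cost G s' i)].

(* The constant outcome only witnesses that outcomes exist. *)
Definition optimum (f : game R n m -> outcome n m -> R) G : outcome n m :=
  [arg min_(s < [ffun _ => Ordinal (ltnW (buses_gt1 G))]) f G s]%O.

(* The default [+oo] is returned only if there is no Nash equilibrium. *)
Definition price_of_stability (f : game R n m -> outcome n m -> R) G : \bar R :=
  \big[Order.min/+oo%E]_(s : outcome n m | nash G s)
    (f G s / f G (optimum f G))%:E.

Definition class_price_of_stability (f : game R n m -> outcome n m -> R)
    (C : set (game R n m)) : \bar R :=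
  ereal_sup [set price_of_stability f G | G in
               [set G | C G /\ 0 < f G (optimum f G)]].

End Games.

(* Main.v *)
Require Import Defs.
From mathcomp Require Import all_boot all_order all_algebra all_fingroup.
From mathcomp Require Import all_classical all_reals ereal.
From mathcomp Require Import zify ring lra.

(* The last [min(n, m)] players in the common order, the far ones, are at
   distance 1 from the destination and pairwise at a small distance [e]; all
   other vertices coincide with the destination. In a Nash equilibrium the far
   players avoid each other, so if there are other players, every bus carries a
   far player, and the others, who are visited before her, each pay at least 2.
   Putting the far players on one bus and the others on another one costs about
   [min(n, m)] in total, and [e] tends to 0. *)

Import Order.TTheory GRing.Theory Num.Theory.
Local Open Scope classical_set_scope.
Local Open Scope ring_scope.

(** * Route lengths, and costs as route lengths *)

Fixpoint route_length {R : realType} {T : Type} (d : T -> T -> R) (x : T)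
    (p : seq T) : R :=
  if p is y :: q then d x y + route_length d y q else 0.

(** The default of [nth] supplies the last stop: index [(size p).+1] is out of range in [x :: p] and
    yields [t], just as [stop] yields [Target]. *)
Lemma route_length_nth {R : realType} {T : Type} (d : T -> T -> R) (t x : T)
    (p : seq T) :
  \sum_(0 <= l < (size p).+1) d (nth t (x :: p) l) (nth t (x :: p) l.+1) =
  route_length d x (rcons p t).
Proof.
elim: p x => [|y p IHp] x /=; first by rewrite big_nat1 addr0.
by rewrite big_nat_recl //= -IHp.
Qed.

(** When every bus uses the identity order, these are the players visited after [i], in order of
    visit. *)
Definition later_riders {n m : nat} (s : outcome n m) (i : 'I_n) : seq 'I_n :=
  [seq k <- enum 'I_n | (s k == s i) && (i < k)%N].

Lemma mem_later_riders {n m : nat} (s : outcome n m) (i k : 'I_n) :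
  (k \in later_riders s i) = (s k == s i) && (i < k)%N.
Proof. by rewrite mem_filter mem_enum andbT. Qed.

Lemma cost_route {R : realType} {n m : nat} (G : game R n m) (s : outcome n m)
    (i : 'I_n) (order1 : forall j, bus_order G j = 1%g) :
  cost G s i =
  route_length (dist G) (Player i)
    (rcons [seq Player k | k <- later_riders s i] Target).
Proof.
rewrite /cost /stop.
set v := visited G s (s i).
have vE : v = [seq k <- enum 'I_n | s k == s i].
  rewrite /v /visited; rewrite (eq_map (g := id)) ?map_id //.
  by move=> k; rewrite order1 perm1.
have iv : i \in v by rewrite vE mem_filter eqxx mem_enum.
have sv : pairwise (fun k l : 'I_n => (k < l)%N) v.
  rewrite vE; apply: pairwise_filter.
  rewrite -(pairwise_map val ltn) val_enum_ord.
  by rewrite -(sorted_pairwise ltn_trans) iota_ltn_sorted.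
have -> : later_riders s i = [seq k : 'I_n <- v | (i < k)%N].
  by rewrite vE -filter_predI; apply: eq_filter => k /=; rewrite andbC.
clear vE; clearbody v.
(* The visited list is increasing, so in the splitting [p ++ i :: q] the later riders are exactly
   [q], and the cost sums from index [size p]. *)
case/splitPr: iv sv => p q.
rewrite pairwise_cat /= => /and3P[pq _ /andP[iq _]].
have pi : all (fun k : 'I_n => (k < i)%N) p.
  by apply: sub_all pq => k /=; case/andP.
have ip : i \notin p.
  by apply/negP => /(allP pi); rewrite ltnn.
rewrite index_cat (negbTE ip) /= eqxx addn0 filter_cat /= ltnn.
have -> : [seq k : 'I_n <- p | (i < k)%N] = [::].
  rewrite -(filter_pred0 p); apply: eq_in_filter => k /(allP pi).
  by move=> /ltnW; rewrite leqNgt => /negbTE.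
rewrite cat0s (all_filterP iq) -route_length_nth size_map size_cat /=.
rewrite -{1}[size p]add0n big_addn addKn.
apply: eq_big_nat => l _.
by rewrite map_cat !nth_cat size_map -addSn !ltnNge !leq_addl !addnK.
Qed.

Lemma route_length_ge_dist {R : realType} {T : Type} (d : T -> T -> R)
    (tri : forall x y w, d x w <= d x y + d y w) (x t : T) (p : seq T) :
  d x t <= route_length d x (rcons p t).
Proof.
elim: p x => [|y p IHp] x /=; first by rewrite addr0.
by apply: le_trans (tri x y t) _; rewrite lerD2l.
Qed.

(** The triangle inequality shortcuts the route both before and after the stop at [f k]. *)
Lemma route_length_ge_via {R : realType} {T : eqType} {S : Type}
    (f : T -> S) (d : S -> S -> R)
    (tri : forall x y w, d x w <= d x y + d y w) (x t : S) (k : T) (p : seq T) :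
  k \in p -> d x (f k) + d (f k) t <= route_length d x (rcons (map f p) t).
Proof.
elim: p x => [//|y p IHp] x; rewrite inE => /predU1P[<-|kp] /=.
  by rewrite lerD2l route_length_ge_dist.
apply: le_trans (_ : d x (f y) + (d (f y) (f k) + d (f k) t) <= _).
  by rewrite addrA lerD2r.
by rewrite lerD2l IHp.
Qed.

(** * The metric game with a cluster of far players *)

Section ClusterGame.
Context {R : realType} {n m : nat} (n_gt0 : (0 < n)%N) (m_gt1 : (1 < m)%N).
Context (e : R) (e_gt0 : 0 < e) (e_le1 : e <= 1).
Implicit Types (x y w : vertex n) (i k : 'I_n) (s : outcome n m).

(** Subtraction is truncated: if [n <= m], every player is far. *)
Definition far (i : 'I_n) : bool := (n - m <= i)%N.

(** [None] is the single point shared by the source, the destination and the near players. *)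
Definition far_point (x : vertex n) : option 'I_n :=
  if x is Player i then if far i then Some i else None else None.

Definition cluster_dist (x y : vertex n) : R :=
  match far_point x, far_point y with
  | None, None => 0
  | Some i, Some k => if i == k then 0 else e
  | _, _ => 1
  end.

Lemma cluster_dist_ge0 x y : 0 <= cluster_dist x y.
Proof.
rewrite /cluster_dist; case: far_point => [i|]; case: far_point => [k|] //.
by case: ifP => // _; exact: ltW.
Qed.

Lemma cluster_dist_sym x y : cluster_dist x y = cluster_dist y x.
Proof.
by rewrite /cluster_dist; case: far_point => [i|]; case: far_point => [k|] //;
  rewrite eq_sym.
Qed.

Lemma cluster_dist_refl x : cluster_dist x x = 0.
Proof. by rewrite /cluster_dist; case: far_point => [i|] //; rewrite eqxx. Qed.

Lemma cluster_dist_triangle x y w :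
  cluster_dist x w <= cluster_dist x y + cluster_dist y w.
Proof.
have e0 := e_gt0; have e1 := e_le1.
rewrite /cluster_dist; case: far_point => [i|]; case: far_point => [k|];
  case: far_point => [l|]; try by do ?case: ifP => _; lra.
case: (eqVneq i l) => [->|_]; first by lra.
by do 2?case: ifP => _; lra.
Qed.

Definition cluster_game : game R n m :=
  @Game R n m n_gt0 m_gt1 cluster_dist cluster_dist_ge0 cluster_dist_sym
    cluster_dist_refl (fun=> 1%g).

Local Notation G := cluster_game.

(** * Bounds on the cost of one player *)

Lemma cluster_cost s i :
  cost G s i =
  route_length cluster_dist (Player i)
    (rcons [seq Player k | k <- later_riders s i] Target).
Proof. exact: cost_route. Qed.

Lemma cluster_dist_Target i : cluster_dist (Player i) Target = (far i)%:R.
Proof. by rewrite /cluster_dist /=; case: ifP. Qed.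

Lemma cluster_dist_near_far i k :
  ~~ far i -> far k -> cluster_dist (Player i) (Player k) = 1.
Proof. by move=> /negbTE fi fk; rewrite /cluster_dist /= fi fk. Qed.

Lemma cluster_cost_ge s i : (far i)%:R <= cost G s i.
Proof.
rewrite cluster_cost -cluster_dist_Target.
exact: (route_length_ge_dist _ cluster_dist_triangle).
Qed.

(** Far players come last in the common order, so the bus carrying [i] must still go out to [k] and
    back. *)
Lemma cluster_cost_near_ge s i k :
  ~~ far i -> far k -> s k = s i -> 2 <= cost G s i.
Proof.
move=> fi fk ski; rewrite cluster_cost.
have ik : k \in later_riders s i.
  rewrite mem_later_riders ski eqxx.
  by move: fi fk; rewrite /far -ltnNge; exact: leq_trans.
apply: le_trans (route_length_ge_via _ _ cluster_dist_triangle _ _ _ _ ik).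
by rewrite cluster_dist_near_far // cluster_dist_Target fk.
Qed.

(** The route via [k] has length at least [e + 1]; the strict excess over 1 is what makes a
    deviation profitable. *)
Lemma cluster_cost_far_gt s i k :
  far i -> s k = s i -> (i < k)%N -> 1 < cost G s i.
Proof.
move=> fi ski ik; rewrite cluster_cost.
have kl : k \in later_riders s i by rewrite mem_later_riders ski eqxx.
apply: lt_le_trans (route_length_ge_via _ _ cluster_dist_triangle _ _ _ _ kl).
have fk : far k by rewrite /far (leq_trans fi) // ltnW.
rewrite cluster_dist_Target fk /cluster_dist /= fi fk.
by rewrite -val_eqE /= ltn_eqF // ltrDr.
Qed.

(** Each far stop is charged 1 for arriving and 1 for leaving, a far starting point only for
    leaving; legs inside the cluster cost at most [e <= 1]. *)
Lemma cluster_route_le x (p : seq 'I_n) :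
  route_length cluster_dist x (rcons [seq Player k | k <- p] Target) <=
  (far_point x != None)%:R + 2 * (count far p)%:R.
Proof.
have e0 := e_gt0; have e1 := e_le1.
elim: p x => [|k p IHp] x /=.
  by rewrite /cluster_dist /=; case: far_point => [i|] /=; lra.
have := IHp (Player k); rewrite natrD.
set L := route_length _ _ _; move: (count _ _) => c.
rewrite /cluster_dist /=; case: (far k); case: far_point => [i|] /=;
  do ?case: ifP => _; lra.
Qed.

Lemma cluster_cost_le s i :
  cost G s i <= (far i)%:R + 2 * (count far (later_riders s i))%:R.
Proof.
rewrite cluster_cost; apply: le_trans (cluster_route_le _ _) _ => /=.
by case: (far i).
Qed.

Lemma cluster_route_far_le i (p : seq 'I_n) : far i -> all far p ->
  route_length cluster_dist (Player i) (rcons [seq Player k | k <- p] Target) <=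
  1 + e * (size p)%:R.
Proof.
have e0 := e_gt0.
elim: p i => [|k p IHp] i fi /=.
  by rewrite cluster_dist_Target fi mulr0.
move=> /andP[fk fp]; have := IHp k fk fp.
set L := route_length _ _ _; rewrite /cluster_dist /= fi fk -natr1.
by move: (size p) => c; case: ifP => _; lra.
Qed.

Lemma far_later s i k : far i -> k \in later_riders s i -> far k.
Proof.
by move=> fi; rewrite mem_later_riders => /andP[_ /ltnW]; exact: leq_trans.
Qed.

(** * Social cost in equilibrium and at the optimum *)

Lemma sum_far (x y : R) :
  \sum_(i < n) (if far i then x else y) =
  x * (n - (n - m))%:R + y * (n - m)%:R.
Proof.
transitivity (\sum_(0 <= i < n) if (n - m <= i)%N then x else y).
  by rewrite big_mkord.
rewrite (@big_cat_nat _ _ _ (n - m)%N) ?leq_subr //= addrC; congr (_ + _).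
  rewrite (eq_big_nat _ _ (F2 := fun=> x)) ?sumr_const_nat ?mulr_natr //.
  by move=> i /andP[->].
rewrite (eq_big_nat _ _ (F2 := fun=> y)) ?sumr_const_nat ?subn0 ?mulr_natr //.
by move=> i /andP[_ ]; rewrite ltnNge => /negbTE->.
Qed.

(* If some bus carried no far player, two of the [m] far players would share
   a bus, and the earlier of them would rather travel alone. *)
Lemma nash_far_rider s j : (m < n)%N -> nash G s -> exists2 k, far k & s k = j.
Proof.
move=> mn /forallP nashs.
have lt_n (l : 'I_m) : (n - m + l < n)%N by case: l => l /=; lia.
(* [g] lists the buses of the last [m] players; if injective, it is onto, and bus [j] carries a far
   player. *)
pose g (l : 'I_m) := s (Ordinal (lt_n l)).
have far_lt l : far (Ordinal (lt_n l)) by rewrite /far /= leq_addr.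
case: (pselect (injective g)) => [/injF_bij[h _ hK]|ninj].
  by exists (Ordinal (lt_n (h j))) => //; rewrite -/(g _) hK.
apply: contrapT => nofar; apply: ninj.
suff lt_inj (l l' : 'I_m) : (l < l')%N -> g l <> g l'.
  move=> l l' gll'; apply/val_inj; case: (ltngtP l l') => // /lt_inj.
    by rewrite gll'.
  by rewrite gll'.
move=> ll' gll'; set i := Ordinal (lt_n l).
have fi : far i by exact: far_lt.
have ci : 1 < cost G s i.
  apply: (@cluster_cost_far_gt _ _ (Ordinal (lt_n l'))) => //=.
  by rewrite ltn_add2l.
pose s' : outcome n m := [ffun k => if k == i then j else s k].
have := nashs i => /forallP/(_ s') /implyP; rewrite ffunE eqxx.
have -> : j != s i by apply/eqP => ji; apply: nofar; exists i.
have -> : [forall k, (k != i) ==> (s' k == s k)].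
  by apply/forallP => k; apply/implyP => /negbTE ki; rewrite ffunE ki.
move=> /(_ isT); apply/negP; rewrite -ltNge; apply: le_lt_trans ci.
(* Anyone visited after the far player [i] is far too, and bus [j] had no far player before the
   move. *)
rewrite cluster_cost; have -> : later_riders s' i = [::].
  apply/eqP; rewrite -size_eq0 size_filter -leqn0 leqNgt -has_count.
  apply/hasPn => k _; rewrite !ffunE eqxx; apply/negP => /andP[].
  case: (eqVneq k i) => [->|_ /eqP skj ik]; first by rewrite ltnn.
  by apply: nofar; exists k => //; rewrite /far (leq_trans fi) // ltnW.
by rewrite /= cluster_dist_Target fi addr0.
Qed.

Lemma nash_utilitarian_ge s : nash G s ->
  (n - (n - m))%:R + 2 * (n - m)%:R <= utilitarian G s.
Proof.
move=> nashs; rewrite -[X in X + _]mul1r -sum_far; apply: ler_sum => i _.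
case: ifPn => fi; first by have := cluster_cost_ge s i; rewrite fi.
have mn : (m < n)%N by move: fi; rewrite /far; lia.
by have [k fk] := nash_far_rider _ (s i) mn nashs; exact: cluster_cost_near_ge.
Qed.

Lemma cluster_utilitarian_ge s : (n - (n - m))%:R <= utilitarian G s.
Proof.
rewrite -[X in X <= _]mul1r -[X in X <= _]addr0 -(mul0r (n - m)%:R) -sum_far.
by apply: ler_sum => i _; have := cluster_cost_ge s i; case: (far i).
Qed.

Lemma cluster_optimum_le :
  utilitarian G (optimum utilitarian G) <= (1 + e * n%:R) * (n - (n - m))%:R.
Proof.
pose s : outcome n m :=
  [ffun i => if far i then Ordinal (ltnW m_gt1) else Ordinal m_gt1].
apply: (@le_trans _ _ (utilitarian G s)).
  by rewrite /optimum; case: arg_minP => // s0 _; apply.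
rewrite -[leRHS]addr0 -(mul0r (n - m)%:R) -sum_far.
apply: ler_sum => i _; case: ifPn => fi.
  (* A far player meets only far players afterwards: at most [n] legs of length at most [e], then
     1. *)
  rewrite cluster_cost; apply: le_trans (cluster_route_far_le _ _ fi _) _.
    by apply/allP => k; exact: far_later.
  rewrite lerD2l ler_pM2l // ler_nat size_filter.
  by rewrite (leq_trans (count_size _ _)) // size_enum_ord.
(* A near player shares her bus with near players only and pays nothing. *)
apply: le_trans (cluster_cost_le _ _) _.
rewrite (negbTE fi) add0r (_ : count _ _ = 0%N) ?mulr0 //.
apply/eqP; rewrite -leqn0 leqNgt -has_count; apply/hasPn => k.
rewrite mem_later_riders !ffunE (negbTE fi) => /andP[+ _].
by case: (far k).
Qed.

(** * Existence of a Nash equilibrium *)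

Lemma far_mod_inj i k : far i -> far k -> i = k %[mod m] -> i = k.
Proof.
wlog ik : i k / (i <= k)%N.
  by move=> ih; case: (leqP i k) => [|/ltnW] /ih // H fi fk /esym /H ->.
rewrite /far => fi fk /esym/eqP; rewrite eqn_mod_dvd // => mki.
apply/val_inj => /=; have kn := ltn_ord k.
have [|ki] := posnP (k - i); first by lia.
by have := dvdn_leq ki mki; lia.
Qed.

Lemma far_mod_surj (j : 'I_m) : (m <= n)%N -> exists2 k, far k & (k %% m = j)%N.
Proof.
move=> mn; have jm := ltn_ord j; have m_gt0 := ltnW m_gt1.
have qr := divn_eq (n.-1 - j) m; have rm := ltn_pmod (n.-1 - j) m_gt0.
set q := (_ %/ _)%N in qr; set r := (_ %% _)%N in qr rm.
have kn : (q * m + j < n)%N by move: (q * m)%N qr => qm qr; lia.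
(* This is the largest index below [n] congruent to [j]; it equals [n - 1 - r] with [r < m], hence
   is far. *)
exists (Ordinal kn); last by rewrite /= modnMDl modn_small.
by rewrite /far /=; move: (q * m)%N qr {kn} => qm qr; lia.
Qed.

(** Assigning players to buses by residue modulo [m] puts at most one far player on each bus. Far
    players then pay their minimum 1. Near players pay at most 2, and if there are any, every bus
    they could move to has a far player and costs them at least 2. *)
Lemma cluster_nash_exists : exists s, nash G s.
Proof.
have m_gt0 := ltnW m_gt1.
pose s : outcome n m := [ffun k : 'I_n => Ordinal (ltn_pmod k m_gt0)].
have sE k l : s k = s l -> k = l %[mod m].
  by rewrite !ffunE => /(congr1 val).
exists s; apply/forallP => i; apply/forallP => s'; apply/implyP.
move=> /andP[_ /forallP s's].
apply: le_trans (cluster_cost_le _ _) _.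
case: (boolP (far i)) => fi.
  rewrite (_ : count _ _ = 0%N); last first.
    apply/eqP; rewrite -leqn0 leqNgt -has_count; apply/hasPn => k kl.
    apply/negP => fk; move: kl; rewrite mem_later_riders => /andP[/eqP/sE ski].
    by rewrite (far_mod_inj _ _ fk fi ski) ltnn.
  by have := cluster_cost_ge s' i; rewrite fi mulr0 addr0.
apply: (@le_trans _ _ 2).
  rewrite add0r -[leRHS]mulr1 ler_pM2l // -[1]/(1%:R) ler_nat.
  rewrite -size_filter.
  have : uniq [seq k <- later_riders s i | far k].
    by do 2!apply: filter_uniq; exact: enum_uniq.
  have : {subset [seq k <- later_riders s i | far k] <=
          [pred k | far k && (s k == s i)]}.
    by move=> k; rewrite mem_filter mem_later_riders inE; case/and3P => -> ->.
  case: [seq k <- later_riders s i | far k] => [|k [|l q]] //= sub.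
  have /andP[fk /eqP/sE ki] := sub k (mem_head _ _).
  have /andP[fl /eqP/sE li] : l \in [pred k | far k && (s k == s i)].
    by apply: sub; rewrite !inE eqxx orbT.
  have -> : k = l by apply: far_mod_inj; rewrite ?ki ?li.
  by rewrite mem_head.
have mn : (m <= n)%N by move: fi; rewrite /far; lia.
have [k fk kj] := far_mod_surj (s' i) mn.
apply: (cluster_cost_near_ge _ _ _ fi fk).
have ki : k != i by apply: contraNneq fi => <-.
have /implyP/(_ ki)/eqP -> := s's k.
by apply/val_inj; rewrite ffunE.
Qed.

(** * The price of stability and the limit in [e] *)

Lemma cluster_price_of_stability_ge :
  ((((n - (n - m))%:R + 2 * (n - m)%:R) /
     ((1 + e * n%:R) * (n - (n - m))%:R))%:E <=
  price_of_stability utilitarian G)%E.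
Proof.
have a_gt0 : 0 < (n - (n - m))%:R :> R.
  by rewrite ltr0n subn_gt0; have := n_gt0; have := m_gt1; lia.
have opt_gt0 : 0 < utilitarian G (optimum utilitarian G).
  by apply: lt_le_trans a_gt0 _; exact: cluster_utilitarian_ge.
rewrite /price_of_stability; elim/big_ind: _ => [|u v lu lv|s nashs].
- exact: leey.
- by rewrite le_min lu.
have hi_gt0 : 0 < (1 + e * n%:R) * (n - (n - m))%:R.
  by rewrite mulr_gt0 // ltr_wpDr // mulr_ge0 // ltW.
rewrite lee_fin; apply: ler_pM.
- by rewrite addr_ge0 // mulr_ge0.
- by rewrite invr_ge0 ltW.
- exact: nash_utilitarian_ge.
- by rewrite lef_pV2 ?posrE // cluster_optimum_le.
Qed.

End ClusterGame.

Theorem proposition4p2 (R : realType) (n m : nat)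
    (n_gt0 : (0 < n)%N) (m_gt1 : (1 < m)%N) :
  ((2 * (n%:R / m%:R) - 1 : R)%:E <=
     class_price_of_stability utilitarian
       [set G : game R n m |
          [/\ is_metric G, (exists s, nash G s) & same_order G]])%E.
Proof.
set a := (n - (n - m))%N; set b := (n - m)%N.
have a_gt0 : (0 < a)%N by rewrite /a; lia.
have am : (a <= m)%N by rewrite /a; lia.
have nab : n%:R = a%:R + b%:R :> R by rewrite -natrD /a /b subnK ?leq_subr.
have a0 : 0 < a%:R :> R by rewrite ltr0n.
have n0 : 0 < n%:R :> R by rewrite ltr0n.
(* The bound at [e = 0]. It equals [2 * (n / a) - 1], and [a], the minimum of [n] and [m], is at
   most [m]. *)
pose r : R := (a%:R + 2 * b%:R) / a%:R.
have r_gt0 : 0 < r by rewrite divr_gt0 // ltr_wpDr // mulr_ge0.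
apply: (@le_trans _ _ r%:E).
  rewrite lee_fin.
  have -> : r = 2 * (n%:R / a%:R) - 1.
    by rewrite /r nab; field; rewrite gt_eqF.
  rewrite lerD2r ler_pM2l // ler_pM2l // lef_pV2 ?posrE ?ltr0n //.
    by rewrite ler_nat.
  exact: leq_trans am.
apply/lee_addgt0Pr => d d0.
(* With this choice [e * r * n = d - e * d <= d], which gives [r - d <= r / (1 + e * n)]; it also
   ensures [e <= 1]. *)
pose e := d / (d + r * n%:R).
have rn0 : 0 < r * n%:R by rewrite mulr_gt0.
have e_gt0 : 0 < e by rewrite divr_gt0 // addr_gt0.
have e_le1 : e <= 1 by rewrite ler_pdivrMr ?addr_gt0 // mul1r lerDl ltW.
have ee : e * (d + r * n%:R) = d by rewrite divfK // gt_eqF // addr_gt0.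
clearbody e.
pose G := cluster_game n_gt0 m_gt1 e e_gt0.
apply: (@le_trans _ _ (price_of_stability utilitarian G + d%:E)%E); last first.
  rewrite leeD2r //; apply: ereal_sup_ubound; eexists; last by reflexivity.
  split; last first.
    by apply: lt_le_trans (cluster_utilitarian_ge _ _ _ _ _ _).
  split => //; first exact: cluster_dist_triangle.
  exact: cluster_nash_exists.
have := cluster_price_of_stability_ge n_gt0 m_gt1 e e_gt0 e_le1.
move=> /(leeD2r d%:E); apply: le_trans.
rewrite -EFinD lee_fin -/a -/b.
rewrite -lerBlDr.
have en : 0 < 1 + e * n%:R by rewrite ltr_wpDr // mulr_ge0 // ltW.
have -> : (a%:R + 2 * b%:R) / ((1 + e * n%:R) * a%:R) = r / (1 + e * n%:R).
  by rewrite /r; field; rewrite !gt_eqF.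
rewrite ler_pdivlMr //.
have den : 0 <= d * (e * n%:R) by rewrite !mulr_ge0 // ltW.
have ed : 0 <= e * d by rewrite mulr_ge0 // ltW.
by lra.
Qed.
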